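(* Let $0\le m_2\le m_1$ be integers, and let $W_{m_1,m_2}$ and $T_{m_1,m_2}$ be the random variables of the card guessing game described in the context. The joint distribution of $W_{m_1,m_2}$ and $T_{m_1,m_2}$ is, for integers $0\le \ell\le m_1$ and $0\le k\le m_2$, given by $$ \mathbb{P}\{W_{m_1,m_2}=k \wedge T_{m_1,m_2}=\ell\}= \begin{cases} \dfrac{\binom{m_1+m_2-\ell-1}{m_2-1}-\binom{m_1+m_2-\ell-1}{m_1-1}}{\binom{m_1+m_2}{m_1}}, & k=0 \text{ and } m_2,\ell\ge 1,\\[2ex] \dfrac{2^{k}\binom{m_1+m_2-\ell-k}{m_1-1}-2^{k+1}\binom{m_1+m_2-\ell-k-1}{m_1-1}}{\binom{m_1+m_2}{m_1}}, & \ell,k\ge 1 \text{ and } (m_1,m_2)\ne(\ell,k),\\[2ex] 1, & k=m_2=0 \text{ and } \ell=m_1,\\ 1, & m_1=m_2=k=\ell=1,\\ 0, & \text{otherwise}, \end{cases} $$ and outside the range $0\le\ell\le m_1$, $0\le k\le m_2$ the probabilities are zero.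
   Context: Card guessing game: a deck consists of $m_1$ cards of one colour (red) and $m_2$ cards of another colour (black), with integers $0\le m_2\le m_1$, in uniformly random order. The cards are drawn from the top one at a time and discarded until the deck is empty. Before each draw the guesser knows the numbers of remaining red and black cards and guesses the colour of the next card so as to maximize the probability of being correct: the colour with strictly more remaining cards is guessed; if both colours have equally many remaining cards, either colour may be guessed (without information on the order of the remaining cards), with success probability $1/2$. $T_{m_1,m_2}$ is the number of correct guesses made with success probability $p=1$ (i.e. when only one colour remains). $W_{m_1,m_2}$ is the number of times during the process (including the initial state) at which the numbers of remaining red and black cards are equal and non-zero. Convention: $\binom{n}{j}=0$ for integers $j>n\ge 0$. *)

(* Defs.v *)
From mathcomp Require Import all_boot all_order all_fingroup all_algebra.

Set Implicit Arguments.
Unset Strict Implicit.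
Unset Printing Implicit Defensive.

Import Order.TTheory GRing.Theory Num.Theory.
Local Open Scope ring_scope.

Definition unif_prob (Omega : finType) (E : pred Omega) : rat :=
  #|E|%:R / #|Omega|%:R.

(* The cards are the elements of 'I_(m1 + m2), those below m1 being red. A deck
   order is a permutation s, with s t the card drawn at time t. Colours are
   booleans: true is red, false is black. *)
Definition colours (m1 m2 : nat) (s : {perm 'I_(m1 + m2)}) : seq bool :=
  [seq (s t < m1)%N | t <- enum 'I_(m1 + m2)].

Definition remaining (c : bool) (w : seq bool) (t : nat) : nat :=
  count_mem c (drop t w).

(* The tie-breaking rule may use the colours already drawn, take t w, and
   nothing about the cards still in the deck. *)
Definition guess (tie : seq bool -> bool) (w : seq bool) (t : nat) : bool :=
  if (remaining false w t < remaining true w t)%N then true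
  else if (remaining true w t < remaining false w t)%N then false
  else tie (take t w).

(* Conditional probability, given the colours already drawn, that the guess is
   correct; only used for t < size w. *)
Definition success_prob (tie : seq bool -> bool) (w : seq bool) (t : nat)
    : rat :=
  (remaining (guess tie w t) w t)%:R / (size w - t)%N%:R.

Definition T (tie : seq bool -> bool) (w : seq bool) : nat :=
  count (fun t => (guess tie w t == nth true w t) && (success_prob tie w t == 1))
        (iota 0 (size w)).

(* The times are 0, ..., size w, with time 0 the full deck. *)
Definition W (w : seq bool) : nat :=
  count (fun t => (remaining true w t == remaining false w t)
                  && (remaining true w t != 0)%N)
        (iota 0 (size w).+1).

(* Main.v *)
Require Import Defs.
From mathcomp Require Import all_boot all_order all_fingroup all_algebra.
From mathcomp Require Import zify.

Import Order.TTheory GRing.Theory Num.Theory.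
Local Open Scope ring_scope.

(** A uniformly random deck yields each colour word with [m1] reds and [m2]
    blacks equally often ([card_colours]), so every probability here is a count
    of words divided by ['C(m1 + m2, m1)]. A colour word is a lattice path from
    [(m1, m2)] to [(0, 0)] recording the numbers of cards left.

    - A correct guess is certain exactly when one colour remains, because a
      certain guess cannot be wrong; hence [T] is the length of the last run of
      equal colours, whatever the tie-breaking rule ([T_final_run]).
    - [W] counts the visits of the path to the diagonal, away from the origin.

    Let [joint a b k l] be the number of words with [a] reds and [b] blacks for
    which these two quantities are [k] and [l]. As long as both colours are
    present, discarding the first card leaves the final run unchanged and lowers
    the number of ties by one precisely when [a = b]. This gives a Pascal-type
    recursion off the diagonal, with a shift of [k] on it ([joint_step]), and
    the recursion is symmetric in the two colours ([joint_sym]). The closed forms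
    are then checked by induction along the recursion:

    - without ties ([joint_no_tie]) the count is a ballot number: the paths to
      [(l, 1)] from the starting point minus those from its mirror image;
    - with [k >= 1] ties ([joint_ties]) both binomials satisfy Pascal's rule off
      the diagonal, and on the diagonal the two symmetric first steps account
      for the factor 2 that each tie contributes.

    The closed forms are stated additively in [nat], so that no truncated
    subtraction of binomials appears. *)

(** * Counting colour words *)

Definition card_words (n a : nat) (P : pred (seq bool)) : nat :=
  #|[pred w : n.-tuple bool | (count_mem true w == a) && P w]|.

Lemma eq_words (n a : nat) (P Q : pred (seq bool)) :
  (forall w, size w = n -> count_mem true w = a -> P w = Q w) ->
  card_words n a P = card_words n a Q.
Proof.
move=> PQ; apply: eq_card => w; rewrite !inE.
by case: eqP => //= wa; rewrite PQ ?size_tuple.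
Qed.

Lemma words_pred0 (n a : nat) (P : pred (seq bool)) :
  (forall w, size w = n -> count_mem true w = a -> ~~ P w) ->
  card_words n a P = 0%N.
Proof.
move=> P0; apply: eq_card0 => w; rewrite !inE.
by case: eqP => //= wa; apply: negbTE; rewrite P0 ?size_tuple.
Qed.

Lemma card_tuple_cons (n : nat) (Q : pred (seq bool)) :
  #|[pred w : n.+1.-tuple bool | Q w]|
  = (#|[pred w : n.-tuple bool | Q (true :: w)]|
     + #|[pred w : n.-tuple bool | Q (false :: w)]|)%N.
Proof.
rewrite -!sum1_card (reindex (fun u : bool * n.-tuple bool => [tuple of u.1 :: u.2])) /=.
  rewrite -(pair_big_dep xpredT
    (fun (b : bool) (w : n.-tuple bool) => Q (b :: w)) (fun _ _ => 1%N)) /=.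
  by rewrite big_bool.
exists (fun w : n.+1.-tuple bool => (thead w, [tuple of behead w])).
- by move=> [b w] _; congr (_, _); apply: val_inj.
- by move=> w _; rewrite -tuple_eta.
Qed.

(** The two summands are the possible colours of the first card; this is the
    source of every recursion below. *)
Lemma words_consS (n a : nat) (P : pred (seq bool)) :
  card_words n.+1 a.+1 P
  = (card_words n a (fun w => P (true :: w)) + card_words n a.+1 (fun w => P (false :: w)))%N.
Proof.
rewrite /card_words (card_tuple_cons n (fun w => (count_mem true w == a.+1) && P w)).
by congr (_ + _)%N.
Qed.

Lemma words_cons0 (n : nat) (P : pred (seq bool)) :
  card_words n.+1 0 P = card_words n 0 (fun w => P (false :: w)).
Proof.
rewrite /card_words (card_tuple_cons n (fun w => (count_mem true w == 0%N) && P w)).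
by rewrite [X in (X + _)%N]eq_card0.
Qed.

Lemma words_gt (n a : nat) (P : pred (seq bool)) :
  (n < a)%N -> card_words n a P = 0%N.
Proof.
move=> na; apply: words_pred0 => w sw ca.
by have := count_size (pred1 true) w; rewrite sw ca leqNgt na.
Qed.

Lemma words_nil (P : pred (seq bool)) : card_words 0 0 P = P [::].
Proof.
rewrite /card_words -[RHS]muln1.
rewrite (eq_card (B := [pred w | P [::]])); last first.
  by move=> w; rewrite !inE (tuple0 w).
case: (P [::]); last by rewrite eq_card0.
by rewrite (eq_card (B := predT)) // card_tuple expn0.
Qed.

Lemma words_full (n : nat) (P : pred (seq bool)) :
  card_words n n P = P (nseq n true).
Proof.
elim: n P => [|n IH] P; first exact: words_nil.
by rewrite words_consS IH words_gt // addn0.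
Qed.

Lemma words_none (n : nat) (P : pred (seq bool)) :
  card_words n 0 P = P (nseq n false).
Proof. by elim: n P => [|n IH] P; rewrite (words_nil, words_cons0) ?IH. Qed.

Lemma words_predT (n a : nat) : card_words n a xpredT = 'C(n, a).
Proof.
elim: n a => [|n IH] [|a]; rewrite ?words_nil ?words_none ?bin0 //.
  exact: words_gt.
by rewrite words_consS !IH binS addnC.
Qed.

(** * From deck orders to colour words *)

Lemma count_colours (m1 m2 : nat) (s : {perm 'I_(m1 + m2)}) :
  count_mem true (colours s) = m1.
Proof.
rewrite count_map -sum1_count big_enum_cond /= (reindex_inj (@perm_inj _ s^-1%g)) /=.
rewrite (eq_bigl (fun i : 'I_(m1 + m2) => (i < m1)%N)); last first.
  by move=> i; rewrite permKV eqb_id.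
by rewrite -(big_ord_widen_cond _ xpredT (fun=> 1%N)) ?leq_addr // sum1_card card_ord.
Qed.

Lemma size_colours (m1 m2 : nat) (s : {perm 'I_(m1 + m2)}) :
  size (colours s) == (m1 + m2)%N.
Proof. by rewrite size_map size_enum_ord. Qed.

Definition colour_word (m1 m2 : nat) (s : {perm 'I_(m1 + m2)}) :
  (m1 + m2).-tuple bool := Tuple (size_colours m1 m2 s).

Lemma tnth_colour_word (m1 m2 : nat) (s : {perm 'I_(m1 + m2)})
    (t : 'I_(m1 + m2)) :
  tnth (colour_word m1 m2 s) t = (s t < m1)%N.
Proof.
rewrite (tnth_nth true) /= (nth_map t) ?size_enum_ord //.
by rewrite nth_ord_enum.
Qed.

Lemma count_mem_false (w : seq bool) :
  count_mem false w = (size w - count_mem true w)%N.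
Proof.
rewrite -(count_predC (pred1 true) w) addKn.
by apply: eq_count; case.
Qed.

(** Two words with the same number of reds differ by a permutation [p] of the
    times, and precomposition with [p] maps one fibre bijectively onto the
    other. *)
Lemma card_colour_fibre (m1 m2 : nat) (w w' : (m1 + m2).-tuple bool) :
  count_mem true w = count_mem true w' ->
  #|[set s | colour_word m1 m2 s == w]| = #|[set s | colour_word m1 m2 s == w']|.
Proof.
move=> eqc.
have /tuple_permP[p wE] : perm_eq w' w.
  apply/allP => -[] _ /=; apply/eqP => //.
  by rewrite !count_mem_false !size_tuple eqc.
have {}wE : w' = [tuple tnth w (p i) | i < m1 + m2] by apply: val_inj.
rewrite -[RHS](card_preimset _ (mulgI p)).
apply: eq_card => s; rewrite !inE wE.
have tp t : tnth (colour_word m1 m2 (p * s)) t = tnth (colour_word m1 m2 s) (p t).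
  by rewrite !tnth_colour_word permM.
apply/eqP/eqP => [<-|e].
  by apply: eq_from_tnth => t; rewrite tnth_mktuple tp.
by apply: eq_from_tnth => t; rewrite -(permKV p t) -tp e tnth_mktuple.
Qed.

(** The constant [c] is the common size of the fibres, taken at the identity
    permutation; keeping its value [m1! m2!] implicit suffices because it
    cancels in every probability. *)
Lemma card_colours (m1 m2 : nat) : exists2 c : nat, (0 < c)%N &
  forall P : pred (seq bool),
    #|(fun s : {perm 'I_(m1 + m2)} => P (colours s))|
      = (card_words (m1 + m2) m1 P * c)%N.
Proof.
pose c := #|[set s | colour_word m1 m2 s == colour_word m1 m2 1]|.
exists c; first by apply/card_gt0P; exists 1%g; rewrite inE.
move=> P; rewrite -sum1_card.
rewrite (partition_big (colour_word m1 m2)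
  (fun w => (count_mem true w == m1) && P w)) /=; last first.
  by move=> s Ps; rewrite count_colours eqxx.
rewrite /card_words -sum_nat_const; apply: eq_bigr => w /andP[/eqP wm Pw].
rewrite /c (card_colour_fibre _ _ _ w) ?count_colours // -sum1_card; apply: eq_bigl => s.
rewrite inE unfold_in.
by apply: andb_idl => /eqP sw; move: Pw; rewrite -sw.
Qed.

Lemma unif_prob_colours (m1 m2 : nat) (P : pred (seq bool)) :
  unif_prob (fun s : {perm 'I_(m1 + m2)} => P (colours s))
  = (card_words (m1 + m2) m1 P)%:R / 'C(m1 + m2, m1)%:R.
Proof.
rewrite /unif_prob; have [c c0 cE] := card_colours m1 m2.
rewrite cE -(words_predT (m1 + m2) m1).
have -> : #|{perm 'I_(m1 + m2)}| = (card_words (m1 + m2) m1 xpredT * c)%N.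
  by rewrite -cE; apply: eq_card.
by rewrite !natrM -mulf_div divff ?mulr1 // pnatr_eq0 -lt0n.
Qed.

(** * Certain guesses form the final run *)

(** The time [t] contributes when the cards left at time [t] share one colour.
    Such times form a final segment, so this is the length of the last maximal
    block of equal letters. *)
Definition final_run (w : seq bool) : nat :=
  count (fun t => constant (drop t w)) (iota 0 (size w)).

Lemma constantE (c : bool) (w : seq bool) :
  constant (c :: w) = (count_mem c (c :: w) == size (c :: w)).
Proof. by rewrite /= eqxx add1n eqSS all_count. Qed.

(** When the guessed colour [g] has success probability 1, all remaining cards
    have colour [g], so the guess is right; conversely, on a constant remainder
    the other colour has count 0 and the strict comparison selects the right
    colour without recourse to the tie-breaking value [b]. *)
Lemma sure_guess_constant (d : seq bool) (b : bool) : (0 < size d)%N ->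
  let g := if (count_mem false d < count_mem true d)%N then true
           else if (count_mem true d < count_mem false d)%N then false else b in
  (g == head true d) && ((count_mem g d)%:R / (size d)%:R == 1 :> rat)
  = constant d.
Proof.
move=> d0 g; rewrite (can2_eq (divfK _) (mulfK _)) ?pnatr_eq0 -?lt0n //.
rewrite mul1r eqr_nat; case: d d0 @g => // c d _ g; rewrite constantE -[head _ _]/c.
have [<- //|/eqP gc] := eqVneq g c; apply/esym/negbTE/negP => /eqP cd.
have c0 : count_mem (~~ c) (c :: d) = 0%N.
  apply/eqP; rewrite -(eqn_add2l (count_mem c (c :: d))) addn0 [X in _ == X]cd.
  rewrite -(count_predC (pred1 c)) eqn_add2l; apply/eqP/eq_count.
  by case: (c) => -[].
by apply: gc; rewrite /g; case: (c) cd c0 => -> ->.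
Qed.

Lemma T_final_run (tie : seq bool -> bool) (w : seq bool) :
  T tie w = final_run w.
Proof.
apply: eq_in_count => t; rewrite mem_iota add0n /= => tw.
rewrite /success_prob /guess /remaining -size_drop -[t in nth _ _ t]addn0 -nth_drop nth0.
by rewrite sure_guess_constant // size_drop subn_gt0.
Qed.

Lemma W_cons (c : bool) (w : seq bool) :
  W (c :: w) = ((count_mem true (c :: w) == count_mem false (c :: w))
     && (count_mem true (c :: w) != 0) + W w)%N.
Proof.
rewrite /W -[size (c :: w)]/(size w).+1 -[iota 0 _]/(0 :: iota 1 (size w).+1)%N.
rewrite -[(0 :: _)%N]/([:: 0%N] ++ _) count_cat; congr (_ + _)%N.
  by rewrite [LHS]addn0 /remaining drop0.
by rewrite (iotaDl 1 0) count_map; apply: eq_count => t.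
Qed.

Lemma final_run_cons (c : bool) (w : seq bool) :
  final_run (c :: w) = (constant (c :: w) + final_run w)%N.
Proof. by rewrite /final_run /= (iotaDl 1 0) count_map. Qed.

Lemma final_run_nseq (n : nat) (c : bool) : final_run (nseq n c) = n.
Proof.
elim: n => // n IH.
by rewrite -[nseq _ _]/(c :: nseq n c) final_run_cons IH (constant_nseq n.+1 c).
Qed.

Lemma W_nseq (n : nat) (c : bool) : W (nseq n c) = 0%N.
Proof.
elim: n => // n IH; rewrite W_cons -[c :: _]/(nseq n.+1 c) IH !count_nseq.
by case: c {IH}; rewrite //= mul0n mul1n eq_sym.
Qed.

(** * The recursion on the first draw *)

Definition joint (a b k l : nat) : nat :=
  card_words (a + b) a (fun w => (W w == k) && (final_run w == l)).

Lemma joint_0r (a k l : nat) : joint a 0 k l = (k == 0%N) && (l == a).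
Proof.
rewrite /joint addn0 words_full W_nseq final_run_nseq.
by rewrite eq_sym [in X in _ && X]eq_sym.
Qed.

Lemma joint_0l (b k l : nat) : joint 0 b k l = (k == 0%N) && (l == b).
Proof.
rewrite /joint add0n words_none W_nseq final_run_nseq.
by rewrite eq_sym [in X in _ && X]eq_sym.
Qed.

Lemma mixed_not_constant (w : seq bool) :
  (0 < count_mem true w)%N -> (count_mem true w < size w)%N -> constant w = false.
Proof.
move=> c0 cs; apply/negbTE/negP => /(constantP true)[x wE].
by move: c0 cs; rewrite wE size_nseq count_nseq; case: x {wE} => /=; lia.
Qed.

(** With both colours present the deck is not yet constant, so time 0 never
    contributes to the final run, and it contributes a tie exactly when
    [a = b]. *)
Lemma joint_mixed (a b k l : nat) : (0 < a)%N -> (0 < b)%N ->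
  joint a b k l =
    card_words (a + b) a (fun w => ((a == b) + W (behead w) == k)%N
                           && (final_run (behead w) == l)).
Proof.
move=> a0 b0; apply: eq_words => -[|c w] sw cw; first by rewrite -cw in a0.
rewrite W_cons final_run_cons mixed_not_constant ?cw ?sw ?add0n; try lia.
by rewrite count_mem_false cw sw addKn -lt0n a0 andbT.
Qed.

Lemma joint_step (a b k l : nat) :
  joint a.+1 b.+1 k l =
    if a == b then (if k is k'.+1 then (joint a b.+1 k' l + joint a.+1 b k' l)%N else 0%N)
    else (joint a b.+1 k l + joint a.+1 b k l)%N.
Proof.
rewrite joint_mixed // addSn words_consS /= eqSS.
have [_|_] := eqVneq a b; last by rewrite /joint -addSnnS.
case: k => [|k]; first by rewrite !words_pred0.
by rewrite /joint -addSnnS.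
Qed.

(** The red/black symmetry is obtained from the recursion, whose two branches
    are exchanged. It turns the two first steps from the diagonal into a
    factor 2. *)
Lemma joint_sym (a b k l : nat) : joint a b k l = joint b a k l.
Proof.
elim: a b k => [|a IHa] b k; first by rewrite joint_0l joint_0r.
elim: b k => [|b IHb] k; first by rewrite joint_0l joint_0r.
rewrite !joint_step eq_sym; case: eqP => [_|_]; last by rewrite addnC IHa IHb.
by case: k => // k; rewrite addnC IHa IHb.
Qed.

(** * Closed forms *)

Lemma joint_run0 (a b k : nat) : (0 < a + b)%N -> joint a b k 0 = 0%N.
Proof.
elim: a b k => [|a IHa] b k; first by rewrite joint_0l; case: b => // b; rewrite andbF.
elim: b k => [|b IHb] k _; first by rewrite joint_0r andbF.
rewrite joint_step; case: eqP => _; last by rewrite IHa ?IHb ?addnS.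
by case: k => // k; rewrite IHa ?IHb ?addnS.
Qed.

(** The final run consists of cards of one colour, of which there are at most
    [a] or [b]. *)
Lemma joint_no_tie_run_gt (a b l : nat) : (a < l)%N -> (b < l)%N -> joint a b 0 l = 0%N.
Proof.
elim: a b => [|a IHa] b al bl; first by rewrite joint_0l (gtn_eqF bl).
elim: b bl => [|b IHb] bl; first by rewrite joint_0r (gtn_eqF al).
by rewrite joint_step IHa ?IHb ?if_same //; lia.
Qed.

(** Ballot numbers: a path without ties from [(a, b)] stays strictly on one side
    of the diagonal until [(l, 1)], where the last minority card is drawn. The
    right-hand side counts all paths from [(a, b)] to [(l, 1)], the binomial on
    the left those from the reflected point [(b, a)]; both obey Pascal's
    rule. *)
Lemma joint_no_tie (a b l : nat) : (0 < b)%N -> (b <= a)%N -> (0 < l)%N -> (l <= a)%N ->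
  (joint a b 0 l + 'C(a + b - l - 1, a - 1) = 'C(a + b - l - 1, b - 1))%N.
Proof.
elim: a b => [|a IHa] [|b] // _ ba l0 la.
elim: b ba => [|b IHb] ba.
  rewrite joint_step joint_0r /=; case: eqP => [->|/eqP a0].
    by rewrite add0n subn1 /= !bin0.
  (* For l = a.+1 the final run needs all majority cards, so only the step
     that discards a minority card contributes. *)
  have [->|ln] := eqVneq l a.+1.
    rewrite joint_no_tie_run_gt ?ltnS ?lt0n // addKn subnn subn1 /=.
    by rewrite bin0 bin_small; lia.
  have := IHa 1%N isT _ l0; rewrite subnn !bin0.
  have -> : (a.+1 + 1 - l - 1 = (a + 1 - l - 1).+1)%N by lia.
  rewrite (_ : a.+1 - 1 = (a - 1).+1)%N ?binS; last lia.
  by rewrite [X in (_ + (X + _))%N]bin_small; lia.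
rewrite joint_step; case: eqP => [->|/eqP ab].
  by rewrite add0n.
have := IHb (ltnW ba).
have [->|ln] := eqVneq l a.+1.
  rewrite (joint_no_tie_run_gt a b.+2); try lia.
  have -> : (a.+1 + b.+2 - a.+1 - 1 = b.+1)%N by lia.
  have -> : (a.+1 + b.+1 - a.+1 - 1 = b)%N by lia.
  by rewrite !subn1 /= !binn !bin_small; lia.
have := IHa b.+2 isT _ l0.
have -> : (a.+1 + b.+2 - l - 1 = (a + b.+2 - l - 1).+1)%N by lia.
have -> : (a.+1 + b.+1 - l - 1 = (a + b.+2 - l - 1))%N by lia.
have -> : (a.+1 - 1 = (a - 1).+1)%N by lia.
have -> : (b.+2 - 1 = b.+1)%N by lia.
have -> : (b.+1 - 1 = b)%N by lia.
rewrite !binS; lia.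
Qed.

Lemma joint11 (k l : nat) : joint 1 1 k l = ((k == 1%N) && (l == 1%N)).*2.
Proof.
rewrite joint_step /=; case: k => [|k] //.
by rewrite joint_0l joint_0r eqSS -addnn.
Qed.

(** Pascal's rule in predecessor form. For [N = 0] both sides vanish as [m] is
    positive; this lets the truncated arguments of [joint_ties] go through
    without a case distinction. *)
Lemma bin_pascal (N m : nat) : (0 < m)%N ->
  'C(N, m.+1) = ('C(N - 1, m.+1) + 'C(N - 1, m))%N.
Proof.
case: N => [|N] m0; first by rewrite !bin_small.
by rewrite subSS subn0 binS.
Qed.

(** For [a >= 2] the formula needs no range conditions on [k] and [l]: when a
    top entry truncates to 0, its bottom entry [a - 1] is positive and the
    binomial vanishes, as the count does. For the same reason the formula covers
    [b = 0], which supplies the boundary case of the induction. It fails for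
    [a = b = k = l = 1], where the second binomial should have top entry -1;
    hence the hypothesis [1 < a] and the separate value [joint11]. *)
Lemma joint_ties (a b k l : nat) : (1 < a)%N -> (b <= a)%N -> (0 < k)%N -> (0 < l)%N ->
  (joint a b k l + 2 ^ k.+1 * 'C(a + b - l - k - 1, a - 1)
   = 2 ^ k * 'C(a + b - l - k, a - 1))%N.
Proof.
elim: a b k => // a IHa b k; elim: b k => [|b IHb] k a1 ba k0 l0.
  by rewrite joint_0r (gtn_eqF k0) !bin_small ?muln0 //; lia.
rewrite joint_step; case: eqP => [ab|/eqP ab].
  (* On the diagonal one tie is used up, and both first steps lead to the same
     count at (a.+1, a). For a single tie the remaining path has none, and the
     ballot numbers take over from the induction hypothesis. *)
  subst b; case: k k0 => // k _; rewrite (joint_sym a) addnn -mul2n.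
  have -> : (a.+1 + a.+1 - l - k.+1 = a.+1 + a - l - k)%N by lia.
  have [->|k0] := posnP k; last first.
    by rewrite expnS [in RHS]expnS -!mulnA -mulnDr IHb // ltnW.
  have [la|al] := leqP l a.+1; last first.
    by rewrite joint_no_tie_run_gt ?(ltnW al) // !bin_small; lia.
  have := joint_no_tie a.+1 a l a1 (leqnSn a) l0 la.
  rewrite subn0.
  have -> : (a.+1 + a - l = (a.+1 + a - l - 1).+1)%N by lia.
  have -> : (a.+1 - 1 = (a - 1).+1)%N by lia.
  by rewrite binS !subSS subn0; lia.
have {}ba : (b < a)%N by lia.
(* Here a first step to (1, 1), outside the induction hypothesis, can only
   occur from (2, 1). *)
have [a1'|a1'] := leqP a 1.
  have [-> ->] : a = 1%N /\ b = 0%N by lia.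
  rewrite joint11 joint_0r (gtn_eqF k0) addn0.
  have [->|k1] := eqVneq k 1%N; last by rewrite !bin_small ?muln0 //; lia.
  have [->//|l1] := eqVneq l 1%N.
  by rewrite !bin_small ?muln0 //; lia.
have := IHb k a1 (leqW (ltnW ba)) k0 l0.
have := IHa b.+1 k a1' ba k0 l0.
have -> : (a.+1 + b.+1 - l - k = (a + b.+1).+1 - l - k)%N by lia.
have -> : (a.+1 + b - l - k = (a + b.+1).+1 - l - k - 1)%N by lia.
have -> : (a + b.+1 - l - k = (a + b.+1).+1 - l - k - 1)%N by lia.
have -> : (a.+1 - 1 = (a - 1).+1)%N by lia.
set N := ((a + b.+1).+1 - l - k)%N.
rewrite (bin_pascal N) ?(bin_pascal (N - 1)) ?subn_gt0 // !mulnDr; lia.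
Qed.

Lemma joint_out_of_range (a b k l : nat) : (b <= a)%N ->
  (a < l)%N || (b < k)%N -> joint a b k l = 0%N.
Proof.
move=> ba out; have [k0|k0] := posnP k.
  by rewrite k0 ltn0 orbF in out *; apply: joint_no_tie_run_gt; rewrite // (leq_ltn_trans ba).
have [l0|l0] := posnP l.
  rewrite l0 /= in out *.
  have [ab0|/joint_run0-> //] := posnP (a + b).
  have [-> ->] : a = 0%N /\ b = 0%N by lia.
  by rewrite joint_0l (gtn_eqF k0).
have [b0|b0] := posnP b; first by rewrite b0 joint_0r (gtn_eqF k0).
have [a1|a1] := leqP a 1.
  have [a_1 b_1] : a = 1%N /\ b = 1%N by lia.
  by rewrite a_1 b_1 in out *; rewrite joint11; case/orP: out => /gtn_eqF->; rewrite ?andbF.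
have := joint_ties a b k l a1 ba k0 l0.
by rewrite [X in _ = (_ * X)%N]bin_small; lia.
Qed.

Lemma prob_joint (m1 m2 : nat) (tie : seq bool -> bool) (k l : nat) :
  unif_prob (fun s : {perm 'I_(m1 + m2)} =>
    (W (colours s) == k) && (T tie (colours s) == l))
  = (joint m1 m2 k l)%:R / 'C(m1 + m2, m1)%:R.
Proof.
rewrite (unif_prob_colours _ _ (fun w => (W w == k) && (T tie w == l))).
by congr (_%:R / _); apply: eq_words => w _ _; rewrite T_final_run.
Qed.

Theorem theorem4 (m1 m2 : nat) (tie : seq bool -> bool) (k l : nat) :
  (m2 <= m1)%N ->
  let P := unif_prob (fun s : {perm 'I_(m1 + m2)} =>
             (W (colours s) == k) && (T tie (colours s) == l)) in
  ((l <= m1)%N -> (k <= m2)%N ->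
   P = if [&& k == 0, 1 <= m2 & 1 <= l]%N then
         ('C(m1 + m2 - l - 1, m2 - 1)%:R - 'C(m1 + m2 - l - 1, m1 - 1)%:R)
           / 'C(m1 + m2, m1)%:R
       else if [&& 1 <= l, 1 <= k & (m1, m2) != (l, k)]%N then
         (2 ^+ k * 'C(m1 + m2 - l - k, m1 - 1)%:R
            - 2 ^+ k.+1 * 'C(m1 + m2 - l - k - 1, m1 - 1)%:R)
           / 'C(m1 + m2, m1)%:R
       else if [&& k == 0, m2 == 0 & l == m1]%N then 1
       else if [&& m1 == 1, m2 == 1, k == 1 & l == 1]%N then 1
       else 0)
  /\ (~~ ((l <= m1) && (k <= m2))%N -> P = 0).
Proof.
move=> m21 P; rewrite {}/P prob_joint; split; last first.
  by rewrite negb_and -!ltnNge => out; rewrite joint_out_of_range // mul0r.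
move=> lm1 km2.
have [-> /=|k0] := posnP k.
  rewrite andbF; have [m20|m20] := posnP m2.
    rewrite m20 addn0 joint_0r /= !andbF binn divr1.
    by case: eqP.
  have [->|l0] := posnP l.
    by rewrite joint_run0 ?addn_gt0 ?m20 ?orbT //= !andbF mul0r.
  congr (_ / _); apply/eqP; rewrite eq_sym subr_eq -natrD eqr_nat eq_sym.
  by apply/eqP/joint_no_tie.
have [-> /=|l0] := posnP l.
  by rewrite joint_run0 ?mul0r ?andbF //; lia.
have [a1|a1] := leqP m1 1.
  have [-> [-> [-> ->]]] : m1 = 1%N /\ m2 = 1%N /\ k = 1%N /\ l = 1%N by lia.
  by rewrite joint11 /= divff.
have ties := joint_ties m1 m2 k l a1 m21 k0 l0.
(* If (m1, m2) = (l, k), then both binomials are C(0, m1 - 1) with m1 >= 2. *)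
have [[m1l m2k]|_] /= := eqVneq.
  rewrite (gtn_eqF a1) /=; suff -> : joint m1 m2 k l = 0%N by rewrite mul0r.
  by move: ties; rewrite [X in _ = (_ * X)%N]bin_small; lia.
congr (_ / _); apply/eqP; rewrite eq_sym subr_eq -!natrX -!natrM -natrD eqr_nat.
by rewrite ties.
Qed.
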